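(* For any $\tau>0$, the algorithm ''SMO for OC-SVM+'' (described in the context, run with tolerance $\tau$) stops after a finite number of iterations.
   Context: **Data.** $l$ is a positive integer; $x_1,\dots,x_l\in\mathcal X$ are the original patterns and $x_1^*,\dots,x_l^*\in\mathcal X^*$ the privileged patterns. $K(x,y)=(\phi(x)\cdot\phi(y))$ and $K^*(x^*,y^* )=(\phi^*(x^* )\cdot\phi^*(y^* ))$ are kernels given by feature maps $\phi,\phi^*$ into real inner product spaces. The hyperparameters satisfy $1/l<\nu<1$, $\gamma>0$, and $\tau>0$ is a tolerance. **Dual problem (OC-SVM+).** For $\boldsymbol\alpha=(\alpha_1,\dots,\alpha_l,\delta_1,\dots,\delta_l)\in\mathbb R^{2l}$ minimize $$F(\boldsymbol\alpha)=\frac1{\nu l}\sum_{k,m}\alpha_k\alpha_mK(x_k,x_m)+\frac1\gamma\sum_{k,m}(\alpha_k-\delta_k)(\alpha_m-\delta_m)K^*(x_k^*,x_m^* )$$ subject to $\sum_k\alpha_k=\sum_k\delta_k=\nu l$, $\alpha_k\ge0$, $0\le\delta_k\le1$. **Notation.** For the current $\boldsymbol\alpha$: $f_k=\frac1{\nu l}\sum_{p=1}^l\alpha_pK(x_p,x_k)$, $f_k^*=\frac1\gamma\sum_{p=1}^l(\alpha_p-\delta_p)K^*(x_p^*,x_k^* )$, $\Delta f_{ij}=f_i-f_j$, $\Delta f^*_{ij}=f^*_i-f^*_j$, $K_{ij}=\frac1{\nu l}(K(x_i,x_i)-2K(x_i,x_j)+K(x_j,x_j))$, $K^*_{ij}=\frac1\gamma(K^*(x_i^*,x_i^*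 )-2K^*(x_i^*,x_j^* )+K^*(x_j^*,x_j^* ))$. **Steps.** An $\alpha$-step on $(i,j)$ replaces $\alpha_i\leftarrow\alpha_i+t$, $\alpha_j\leftarrow\alpha_j-t$ with $t=-\min\{(\Delta f_{ij}+\Delta f^*_{ij})/(K_{ij}+K^*_{ij}),\ \alpha_i\}$. A $\delta$-step on $(m,n)$ replaces $\delta_m\leftarrow\delta_m+s$, $\delta_n\leftarrow\delta_n-s$ with $s=\min\{\Delta f^*_{mn}/K^*_{mn},\ 1-\delta_m,\ \delta_n\}$. **Caches.** $C$ and $C^*$ are subsets of $\{1,\dots,l\}$ determined at every moment from the current $\boldsymbol\alpha$ by a fixed rule: each of them is the union of a fixed selection of the six disjoint sets of indices $k$ obtained by combining $\alpha_k>0$ or $\alpha_k=0$ with $0<\delta_k<1$, $\delta_k=0$ or $\delta_k=1$, with $C\subseteq C^*$. **Pairs.** For $S\subseteq\{1,\dots,l\}$, $\alpha\text{-pair}(S)=(i,j)$ with $i\in\mathrm{argmax}_{k\in S,\alpha_k>0}(f_k+f_k^* )$, $j\in\mathrm{argmin}_{k\in S}(f_k+f_k^* )$, and its violation is $A(S)=\Delta f_{ij}+\Delta f_{ij}^*$; $\delta\text{-pair}(S)=(m,n)$ with $m\in\mathrm{argmax}_{k\in S,\delta_k<1}f_k^*$, $n\in\mathrm{argmin}_{k\in S,\delta_k>0}f_k^*$, and its violation is $D(S)=\Delta f^*_{mn}$. Ties are broken arbitrarily; if a pair does not exist (empty index set) its violation is $-\infty$. **Algorithm ''SMO for OC-SVM+''**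 (exact arithmetic; caching only affects which values $f_k,f_k^*$ are stored, they always equal the formulas above). Initialization: $\lfloor\nu l\rfloor$ randomly selected coefficients $\delta_k$ are set to $1$, if $\nu l$ is not an integer one more is set to $\nu l-\lfloor\nu l\rfloor$, the remaining ones to $0$; the $\alpha_k$ are initialized in the same way. Each iteration, with $L=\{1,\dots,l\}$, performs the first applicable item: 1. if $A(C)>\tau$ and $A(C)\ge D(C^* )$: $\alpha$-step on $\alpha\text{-pair}(C)$; 2. if $D(C^* )>\tau$ and $A(C)\le D(C^* )$: $\delta$-step on $\delta\text{-pair}(C^* )$; 3. if $A(C^* )>\tau$: $\alpha$-step on $\alpha\text{-pair}(C^* )$; 4. if $A(L)>\tau$ and $A(L)\ge D(L)$: $\alpha$-step on $\alpha\text{-pair}(L)$; 5. if $D(L)>\tau$ and $A(L)\le D(L)$: $\delta$-step on $\delta\text{-pair}(L)$; 6. otherwise stop. *)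

(* Defs.v *)
From HB Require Import structures.
From mathcomp Require Import all_boot all_order all_algebra.
From mathcomp Require Import all_reals.

Set Implicit Arguments.
Unset Strict Implicit.
Unset Printing Implicit Defensive.

Import Order.TTheory GRing.Theory Num.Theory.
Local Open Scope ring_scope.

Record state (R : realType) (l : nat) := State {
  alpha : {ffun 'I_l -> R};
  delta : {ffun 'I_l -> R} }.

Section Initialization.
Variables (R : realType) (l : nat) (nu : R).

(* "Randomly selected" is rendered by an arbitrary choice of A and k0, made
   separately for the alpha's and for the delta's. *)
Definition initial_coefs (v : {ffun 'I_l -> R}) : Prop :=
  exists A : {set 'I_l},
    #|A| = Num.floor (nu * l%:R) :> int /\
    (if nu * l%:R \is a Num.int then
       v = [ffun k => if k \in A then 1 else 0]
     else
       exists k0 : 'I_l, k0 \notin A /\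
         v = [ffun k => if k \in A then 1
                        else if k == k0 then
                          nu * l%:R - (Num.floor (nu * l%:R))%:~R
                        else 0]).

Definition initial (a : state R l) : Prop :=
  initial_coefs (alpha a) /\ initial_coefs (delta a).

End Initialization.

Section Caches.
Variables (R : realType) (l : nat).

(* The six cells: the first component tells alpha_k > 0 from alpha_k = 0;
   in the second one, None stands for 0 < delta_k < 1, Some false for
   delta_k = 0 and Some true for delta_k = 1. *)
Definition cell : finType := (bool * option bool)%type.

Definition cell_set (a : state R l) (c : cell) : {set 'I_l} :=
  [set k | (if c.1 then 0 < alpha a k else alpha a k == 0) &&
           match c.2 with
           | None => 0 < delta a k < 1
           | Some false => delta a k == 0
           | Some true => delta a k == 1
           end].

Definition cache (sel : {set cell}) (a : state R l) : {set 'I_l} :=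
  \bigcup_(c in sel) cell_set a c.

End Caches.

Inductive instruction (l : nat) :=
  | AlphaStep of {set 'I_l}
  | DeltaStep of {set 'I_l}
  | Stop.
Arguments Stop {l}.

Section SMO.
Variables (R : realType) (l : nat) (X Xs : Type).
Variables (K : X -> X -> R) (Ks : Xs -> Xs -> R).
Variables (x : 'I_l -> X) (xs : 'I_l -> Xs) (nu gamma tau : R).
Variables (selC selCs : {set cell}).
Implicit Types (a : state R l) (W : {set 'I_l}) (i j m n k p : 'I_l).

Definition f a k : R :=
  (nu * l%:R)^-1 * \sum_(p < l) alpha a p * K (x p) (x k).

Definition fs a k : R :=
  gamma^-1 * \sum_(p < l) (alpha a p - delta a p) * Ks (xs p) (xs k).

Definition Kdist i j : R :=
  (nu * l%:R)^-1 * (K (x i) (x i) - 2 * K (x i) (x j) + K (x j) (x j)).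

Definition Ksdist i j : R :=
  gamma^-1 * (Ks (xs i) (xs i) - 2 * Ks (xs i) (xs j) + Ks (xs j) (xs j)).

Definition alpha_gap a i j : R := (f a i - f a j) + (fs a i - fs a j).

Definition delta_gap a m n : R := fs a m - fs a n.

(* Division is total (x / 0 = 0), but a step is only taken on a pair of
   positive violation, and then the denominator is positive. *)
Definition alpha_step a i j : state R l :=
  let t := - Num.min (alpha_gap a i j / (Kdist i j + Ksdist i j))
                     (alpha a i) in
  State [ffun k => alpha a k + (if k == i then t else 0)
                             - (if k == j then t else 0)]
        (delta a).

Definition delta_step a m n : state R l :=
  let s := Num.min (delta_gap a m n / Ksdist m n)
                   (Num.min (1 - delta a m) (delta a n)) in
  State (alpha a)
        [ffun k => delta a k + (if k == m then s else 0)
                             - (if k == n then s else 0)].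

Definition alpha_pair a W (ij : 'I_l * 'I_l) : bool :=
  let g k := f a k + fs a k in
  [&& ij.1 \in W, 0 < alpha a ij.1,
      [forall k in W, (0 < alpha a k) ==> (g k <= g ij.1)],
      ij.2 \in W & [forall k in W, g ij.2 <= g k]].

Definition delta_pair a W (mn : 'I_l * 'I_l) : bool :=
  [&& mn.1 \in W, delta a mn.1 < 1,
      [forall k in W, (delta a k < 1) ==> (fs a k <= fs a mn.1)],
      mn.2 \in W, 0 < delta a mn.2 &
      [forall k in W, (0 < delta a k) ==> (fs a mn.2 <= fs a k)]].

(* All pairs of the same set have the same gap, so the pair that [pick]
   returns does not matter. *)
Definition alpha_violation a W : \bar R :=
  if [pick ij | alpha_pair a W ij] is Some ij
  then (alpha_gap a ij.1 ij.2)%:E else -oo%E.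

Definition delta_violation a W : \bar R :=
  if [pick mn | delta_pair a W mn] is Some mn
  then (delta_gap a mn.1 mn.2)%:E else -oo%E.

Definition next_instruction a : instruction l :=
  let C := cache selC a in
  let Cs := cache selCs a in
  let L := [set: 'I_l] in
  let A := alpha_violation a in
  let D := delta_violation a in
  if ((tau%:E < A C) && (D Cs <= A C))%E then AlphaStep C
  else if ((tau%:E < D Cs) && (A C <= D Cs))%E then DeltaStep Cs
  else if (tau%:E < A Cs)%E then AlphaStep Cs
  else if ((tau%:E < A L) && (D L <= A L))%E then AlphaStep L
  else if ((tau%:E < D L) && (A L <= D L))%E then DeltaStep L
  else Stop.

(* A relation rather than a function: ties between pairs are broken
   arbitrarily. *)
Definition iteration a a' : Prop :=
  match next_instruction a with
  | AlphaStep W => exists i j, alpha_pair a W (i, j) /\ a' = alpha_step a i j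
  | DeltaStep W => exists m n, delta_pair a W (m, n) /\ a' = delta_step a m n
  | Stop => False
  end.

(* The values of run after the first state at which the algorithm stops are
   irrelevant. *)
Definition smo_run (run : nat -> state R l) : Prop :=
  initial nu (run 0%N) /\
  forall t : nat, next_instruction (run t) <> Stop ->
    iteration (run t) (run t.+1).

Definition stops_at (run : nat -> state R l) (N : nat) : Prop :=
  next_instruction (run N) = Stop.

(* The algorithm is never stuck, so every partial execution is a prefix of a
   run. *)
Lemma iteration_total a :
  next_instruction a <> Stop -> exists a', iteration a a'.
Proof.
have HA W : (tau%:E < alpha_violation a W)%E -> exists ij, alpha_pair a W ij.
  by rewrite /alpha_violation; case: pickP => // ij Pij _; exists ij.
have HD W : (tau%:E < delta_violation a W)%E -> exists mn, delta_pair a W mn.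
  by rewrite /delta_violation; case: pickP => // mn Pmn _; exists mn.
have GA W : (tau%:E < alpha_violation a W)%E -> exists a' i j,
    alpha_pair a W (i, j) /\ a' = alpha_step a i j.
  by move=> /HA[[i j] Pij]; exists (alpha_step a i j), i, j.
have GD W : (tau%:E < delta_violation a W)%E -> exists a' m n,
    delta_pair a W (m, n) /\ a' = delta_step a m n.
  by move=> /HD[[i j] Pij]; exists (delta_step a i j), i, j.
rewrite /iteration /next_instruction.
case: ifP => [/andP[/GA] //|_]; case: ifP => [/andP[/GD] //|_].
case: ifP => [/GA //|_]; case: ifP => [/andP[/GA] //|_].
by case: ifP => [/andP[/GD]|].
Qed.

End SMO.

(* Main.v *)
(* The dual objective F is nonnegative, and a step that moves an amount u of
   mass along a pair of violation greater than tau decreases it by at least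
   tau * u. Hence, from some time T on, the total amount of moved mass is
   arbitrarily small. After T every step is therefore clipped, since an
   unclipped step has a length bounded below; it follows the strict order of
   the gradient frozen at time T, since the gradient hardly changes; and no
   delta_k visits both 0 and 1. Under these conditions each step strictly
   decreases a natural number, a weighted count of the coefficients that are
   off their bound, so there are only finitely many steps. *)

Require Import Defs.
From HB Require Import structures.
From mathcomp Require Import all_boot all_order all_algebra.
From mathcomp Require Import all_reals.
From mathcomp Require boolp classical_sets.
From mathcomp Require Import ring lra zify.

Set Implicit Arguments.
Unset Strict Implicit.

Import Order.TTheory GRing.Theory Num.Theory.
Local Open Scope ring_scope.

(** * Mass transfers and the integer potential *)

Definition transfer (R : realType) (l : nat) (v : {ffun 'I_l -> R})
    (i j : 'I_l) (u : R) : {ffun 'I_l -> R} :=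
  [ffun k => v k - (if k == i then u else 0) + (if k == j then u else 0)].

Lemma transfer_drift (R : realType) (l : nat) (v : {ffun 'I_l -> R})
    (i j k : 'I_l) (u : R) :
  i != j -> 0 <= u -> `|transfer v i j u k - v k| <= u.
Proof.
move=> ij u0; rewrite ffunE.
have [ki|ki] := eqVneq k i; have [kj|kj] := eqVneq k j.
- by move: ij; rewrite -ki -kj eqxx.
- by rewrite addr0 addrC addKr normrN ger0_norm.
- by rewrite subr0 addrC addKr ger0_norm.
- by rewrite subr0 addr0 subrr normr0.
Qed.

Definition rank (R : realType) (l : nat) (h : 'I_l -> R) (k : 'I_l) : nat :=
  #|[set m | h m < h k]|.

Lemma rank_lt (R : realType) (l : nat) (h : 'I_l -> R) (i j : 'I_l) :
  h i < h j -> (rank h i < rank h j)%N.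
Proof.
move=> hij; apply/proper_card/properP; split.
  by apply/subsetP => m; rewrite !inE => /lt_trans; exact.
by exists i; rewrite !inE ?ltxx.
Qed.

Lemma rank_le (R : realType) (l : nat) (h : 'I_l -> R) (k : 'I_l) :
  (rank h k <= l)%N.
Proof. by rewrite -[leqRHS]card_ord max_card. Qed.

(* Mass flows from small to large values of h. A coefficient in low is only ever
   clipped at 0, the others only at 1. The weights make up for the coefficient
   at the other end of the transfer leaving its own bound. *)
Definition potential (R : realType) (l : nat) (h : 'I_l -> R)
    (low : pred 'I_l) (v : {ffun 'I_l -> R}) : nat :=
  (\sum_k if low k then if (0 < v k)%R then l - rank h k else 0
          else if (v k < 1)%R then (rank h k).+1 else 0)%N.

(** As [rank h i < rank h j <= l], the weight [l - rank h i] freed by clipping a low [i] at 0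
    exceeds what a low [j] can gain, and the weight [(rank h j).+1] freed by clipping [j] at 1
    exceeds what a non-low [i] can gain. In the mixed cases the other end is already counted as off
    its bound and gains nothing. *)
Lemma potential_transfer (R : realType) (l : nat) (h : 'I_l -> R)
    (low : pred 'I_l) (v : {ffun 'I_l -> R}) (i j : 'I_l) (u : R) :
  h i < h j -> 0 < v i -> low j || (v j < 1) ->
  (low i /\ u = v i) \/ (~~ low j /\ u = 1 - v j) ->
  (potential h low (transfer v i j u) < potential h low v)%N.
Proof.
move=> hij vi vj clip.
have ij : i != j by apply: contraTneq hij => ->; rewrite ltxx.
have rij := rank_lt hij; have rj := rank_le h j.
rewrite /potential (bigD1 i) // (bigD1 j) 1?eq_sym //=.
rewrite [in ltnRHS](bigD1 i) // [in ltnRHS](bigD1 j) 1?eq_sym //=.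
rewrite !addnA.
rewrite [X in (_ + X < _)%N](_ : _ =
  (\sum_(k < l | (k != i) && (k != j))
    if low k then if (0 < v k)%R then l - rank h k else 0
    else if (v k < 1)%R then (rank h k).+1 else 0)%N); last first.
  apply: eq_bigr => k /andP[/negPf ki /negPf kj].
  by rewrite ffunE ki kj subr0 addr0.
rewrite ltn_add2r !ffunE !eqxx (negPf ij) eq_sym (negPf ij) subr0 addr0 vi.
case: clip => [[li ->]|[lj ->]].
  rewrite li subrr ltxx add0n.
  move: vj; case: (low j) => /=.
    by move=> _; case: ifP => _; case: ifP => _; lia.
  by move=> ->; case: ifP => _; lia.
move: vj; rewrite (negPf lj) /= => ->.
rewrite [v j + _]addrC subrK ltxx addn0.
case: (low i); first by case: ifP => _; lia.
by case: ifP => _; case: ifP => _; lia.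
Qed.

(** The bound on [u] gives [u ^+ 2 * eta <= u * g], so a shortened line-search step keeps at least
    half of the linear gain [2 * u * g]. *)
Lemma clipped_descent (R : realType) (tau g eta u : R) :
  0 < tau -> tau < g -> 0 < eta -> 0 < u -> u <= g / eta ->
  - 2 * u * g + u ^+ 2 * eta <= - (tau * u).
Proof.
move=> t0 tg e0 u0; rewrite ler_pdivlMr // => ue.
have := ler_wpM2l (ltW u0) ue.
have : tau * u < g * u by rewrite ltr_pM2r.
rewrite expr2; nra.
Qed.

(** * Kernel matrices as inner products of feature vectors *)

Section Gram.
Variables (R : realType) (l : nat) (V : lmodType R) (ip : {dot V for idfun}).
Variables (psi : 'I_l -> V) (G : 'I_l -> 'I_l -> R).
Hypothesis HG : forall p k, G p k = ip (psi p) (psi k).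
Implicit Types (c : 'I_l -> R).

Definition combination c : V := \sum_p c p *: psi p.

Lemma dot_sym (u v : V) : ip u v = ip v u.
Proof. by rewrite hermC expr0 mul1r. Qed.

Lemma dot_gt0 (u : V) : u != 0 -> 0 < ip u u.
Proof. exact: neq0_dnorm_gt0. Qed.

Lemma dot_ge0 (u : V) : 0 <= ip u u.
Proof.
have [->|/dot_gt0/ltW //] := eqVneq u 0; by rewrite linear0l.
Qed.

Lemma dotBl (u v w : V) : ip (u - v) w = ip u w - ip v w.
Proof. exact: linearBl. Qed.

Lemma dotBr (u v w : V) : ip u (v - w) = ip u v - ip u w.
Proof. exact: linearBr. Qed.

Lemma dotZl (r : R) (u v : V) : ip (r *: u) v = r * ip u v.
Proof. exact: linearZl_LR. Qed.

Lemma dotZr (r : R) (u v : V) : ip u (r *: v) = r * ip u v.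
Proof. exact: linearZr_LR. Qed.

Lemma dot_combination c k : ip (combination c) (psi k) = \sum_p c p * G p k.
Proof.
transitivity (\sum_p ip (c p *: psi p) (psi k)); first exact: linear_sumlz.
by apply: eq_bigr => p _; rewrite dotZl HG.
Qed.

Lemma dist_dot i j :
  G i i - 2 * G i j + G j j = ip (psi i - psi j) (psi i - psi j).
Proof. rewrite dotBl !dotBr !HG (dot_sym (psi j) (psi i)); ring. Qed.

Lemma dist_ge0 i j : 0 <= G i i - 2 * G i j + G j j.
Proof. by rewrite dist_dot dot_ge0. Qed.

(** Definiteness of the inner product forces [psi i = psi j]. This later excludes a zero denominator
    in a step of positive violation. *)
Lemma dist_eq0 c i j : G i i - 2 * G i j + G j j = 0 ->
  \sum_p c p * G p i = \sum_p c p * G p j.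
Proof.
rewrite dist_dot => d0; rewrite -!dot_combination.
have [/subr0_eq -> //|/dot_gt0] := eqVneq (psi i - psi j) 0.
by rewrite d0 ltxx.
Qed.

Lemma combination_transfer c i j u :
  combination (fun k => c k - (if k == i then u else 0) +
                              (if k == j then u else 0)) =
  combination c - u *: (psi i - psi j).
Proof.
rewrite /combination.
have one m : \sum_p (if p == m then u else 0) *: psi p = u *: psi m.
  rewrite (bigD1 m) //= eqxx big1 ?addr0 // => p /negPf ->.
  by rewrite scale0r.
under eq_bigr do rewrite scalerDl scalerBl.
by rewrite big_split sumrB !one scalerBr opprB addrA addrAC.
Qed.

Lemma sqnorm_transfer c i j u :
  let w := combination (fun k => c k - (if k == i then u else 0) +
                                       (if k == j then u else 0)) in
  ip w w = ip (combination c) (combination c)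
    - 2 * u * (\sum_p c p * G p i - \sum_p c p * G p j)
    + u ^+ 2 * (G i i - 2 * G i j + G j j).
Proof.
rewrite /= combination_transfer -!dot_combination dist_dot.
set w := combination c; rewrite -(dotBr w).
move: w (psi i - psi j) => w d.
rewrite dotBl !dotBr !dotZl !dotZr (dot_sym d w); ring.
Qed.

End Gram.

(** * Estimates for finite sums and for nonnegative sequences *)

Lemma le_sum_term (R : realType) (I : finType) (F : I -> R) (i : I) :
  (forall k, 0 <= F k) -> F i <= \sum_k F k.
Proof. by move=> F0; rewrite (bigD1 i) //= lerDl sumr_ge0. Qed.

Lemma norm_combination_sub (R : realType) (I : finType) (c c' g : I -> R)
    (d : R) :
  (forall p, `|c p - c' p| <= d) ->
  `|\sum_p c p * g p - \sum_p c' p * g p| <= d * \sum_p `|g p|.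
Proof.
move=> cd; rewrite -sumrB (le_trans (ler_norm_sum _ _ _)) // mulr_sumr.
by apply: ler_sum => p _; rewrite -mulrBl normrM ler_wpM2r.
Qed.

(** [F T] is taken within [e] of the infimum of all the values. *)
Lemma eventually_small_drop (R : realType) (F : nat -> R) (e : R) :
  (forall t, 0 <= F t) -> 0 < e -> exists T, forall t, F T - F t < e.
Proof.
move=> F0 e0; pose E : R -> Prop := fun r => exists t, r = F t.
have Einf : classical_sets.has_inf E.
  by split; [exists (F 0%N), 0%N | exists 0 => _ [t ->]].
have [_ [T ->] FT] := inf_adherent e0 Einf.
exists T => t; rewrite ltrBlDr addrC (lt_le_trans FT) // lerD2r.
by apply: ge_inf; [case: Einf | exists t].
Qed.

(** * Decrease of the dual objective in one iteration *)

Section Descent.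
Variables (R : realType) (l : nat) (X Xs : Type) (V Vs : lmodType R).
Variables (ip : {dot V for idfun}) (ips : {dot Vs for idfun}).
Variables (phi : X -> V) (phis : Xs -> Vs).
Variables (K : X -> X -> R) (Ks : Xs -> Xs -> R).
Hypothesis HK : forall y z, K y z = ip (phi y) (phi z).
Hypothesis HKs : forall y z, Ks y z = ips (phis y) (phis z).
Variables (x : 'I_l -> X) (xs : 'I_l -> Xs) (nu gamma tau : R).
Hypothesis Hnul : 0 < nu * l%:R.
Hypothesis Hgamma : 0 < gamma.
Hypothesis Htau : 0 < tau.
Implicit Types (a b : state R l) (i j m n k : 'I_l).

Local Notation f := (f K x nu).
Local Notation fs := (fs Ks xs gamma).
Local Notation Kd := (Kdist K x nu).
Local Notation Ksd := (Ksdist Ks xs gamma).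
Local Notation agap := (alpha_gap K Ks x xs nu gamma).
Local Notation dgap := (delta_gap Ks xs gamma).

Let HG p k : K (x p) (x k) = ip (phi (x p)) (phi (x k)).
Proof. exact: HK. Qed.

Let HGs p k : Ks (xs p) (xs k) = ips (phis (xs p)) (phis (xs k)).
Proof. exact: HKs. Qed.

(** The dual objective F, its two quadratic forms written as squared norms in feature space, which
    makes nonnegativity immediate. *)
Definition objective a : R :=
  let w := combination (phi \o x) (alpha a) in
  let ws := combination (phis \o xs) (fun k => alpha a k - delta a k) in
  (nu * l%:R)^-1 * ip w w + gamma^-1 * ips ws ws.

Lemma objective_ge0 a : 0 <= objective a.
Proof.
by rewrite addr_ge0 // mulr_ge0 ?dot_ge0 // invr_ge0 ltW.
Qed.

Lemma eq_combination (W : lmodType R) (psi : 'I_l -> W) c c' :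
  c =1 c' -> combination psi c = combination psi c'.
Proof. by move=> cc'; apply: eq_bigr => p _; rewrite cc'. Qed.

Lemma objective_alpha_transfer a i j u :
  objective (State (transfer (alpha a) i j u) (delta a)) =
  objective a - 2 * u * agap a i j + u ^+ 2 * (Kd i j + Ksd i j).
Proof.
rewrite /objective /=.
rewrite (eq_combination (phi \o x) (fun k => ffunE _ k)).
rewrite (@eq_combination _ (phis \o xs) _ (fun k => (alpha a k - delta a k)
  - (if k == i then u else 0) + (if k == j then u else 0))); last first.
  by move=> k; rewrite ffunE; move: (k == i) (k == j) => [] []; ring.
rewrite (sqnorm_transfer HG) (sqnorm_transfer HGs).
rewrite /alpha_gap /Defs.f /Defs.fs /Kdist /Ksdist; ring.
Qed.

Lemma objective_delta_transfer a m n u :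
  objective (State (alpha a) (transfer (delta a) n m u)) =
  objective a - 2 * u * dgap a m n + u ^+ 2 * Ksd m n.
Proof.
rewrite /objective /=.
(* Delta enters only through [alpha - delta], where moving [u] from [n] to [m] acts as a transfer
   from [m] to [n]. *)
rewrite (@eq_combination _ (phis \o xs) _ (fun k => (alpha a k - delta a k)
  - (if k == m then u else 0) + (if k == n then u else 0))); last first.
  by move=> k; rewrite ffunE; move: (k == m) (k == n) => [] []; ring.
rewrite (sqnorm_transfer HGs) /delta_gap /Defs.fs /Ksdist; ring.
Qed.

Lemma Kdist_ge0 i j : 0 <= Kd i j.
Proof. by rewrite mulr_ge0 ?(dist_ge0 HG) // invr_ge0 ltW. Qed.

Lemma Ksdist_ge0 i j : 0 <= Ksd i j.
Proof. by rewrite mulr_ge0 ?(dist_ge0 HGs) // invr_ge0 ltW. Qed.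

Lemma Kdist_eq0 a i j : Kd i j = 0 -> f a i = f a j.
Proof.
move=> /eqP; rewrite mulf_eq0 invr_eq0 gt_eqF //= => /eqP /(dist_eq0 HG) d0.
by congr (_ * _); exact: d0.
Qed.

Lemma Ksdist_eq0 a i j : Ksd i j = 0 -> fs a i = fs a j.
Proof.
move=> /eqP; rewrite mulf_eq0 invr_eq0 gt_eqF //= => /eqP /(dist_eq0 HGs) d0.
by congr (_ * _); exact: (d0 (fun p => alpha a p - delta a p)).
Qed.

Lemma delta_gap_dist_gt0 a m n : 0 < dgap a m n -> 0 < Ksd m n.
Proof.
move=> g0; rewrite lt0r Ksdist_ge0 andbT; apply: contraTneq g0.
by move=> /(Ksdist_eq0 a) e; rewrite /delta_gap e subrr ltxx.
Qed.

Lemma alpha_gap_dist_gt0 a i j : 0 < agap a i j -> 0 < Kd i j + Ksd i j.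
Proof.
move=> g0; rewrite lt0r addr_ge0 ?Kdist_ge0 ?Ksdist_ge0 // andbT.
rewrite paddr_eq0 ?Kdist_ge0 ?Ksdist_ge0 //; apply: contraTN g0.
move=> /andP[/eqP/(Kdist_eq0 a) e /eqP/(Ksdist_eq0 a) es].
by rewrite /alpha_gap e es !subrr addr0 ltxx.
Qed.

(* In each constructor, the last premise says that either the step reaches the
   minimum of the objective along the line, and then it is long, or it is
   clipped by the constraints. *)
Inductive descent_move a b : Prop :=
| AlphaMove i j u of tau < agap a i j & 0 < alpha a i & 0 < u
    & objective b <= objective a - tau * u
    & alpha b = transfer (alpha a) i j u & delta b = delta a
    & tau < u * (Kd i j + Ksd i j) \/ u = alpha a i
| DeltaMove m n u of tau < dgap a m n & delta a m < 1 & 0 < delta a n & 0 < u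
    & objective b <= objective a - tau * u
    & alpha b = alpha a & delta b = transfer (delta a) n m u
    & [\/ tau < u * Ksd m n, u = delta a n | u = 1 - delta a m].

Lemma alpha_step_descent a i j : tau < agap a i j -> 0 < alpha a i ->
  descent_move a (alpha_step K Ks x xs nu gamma a i j).
Proof.
move=> g ai; have g0 := lt_trans Htau g; have e0 := alpha_gap_dist_gt0 g0.
rewrite /alpha_step; set eta := Kd i j + Ksd i j in e0 *.
set u := Num.min (agap a i j / eta) (alpha a i).
have u0 : 0 < u by rewrite lt_min ai divr_gt0.
have ule : u <= agap a i j / eta by rewrite ge_min lexx.
have -> : State [ffun k => alpha a k + (if k == i then - u else 0)
                   - (if k == j then - u else 0)] (delta a) =
          State (transfer (alpha a) i j u) (delta a).
  congr State; apply/ffunP => k; rewrite !ffunE.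
  by do 2![case: ifP => _]; ring.
apply: (@AlphaMove _ _ i j u) => //.
  rewrite objective_alpha_transfer -/eta.
  have := clipped_descent Htau g e0 u0 ule; lra.
(* When the quotient is the minimum, [u * eta] is the gap itself, which exceeds [tau]. *)
rewrite /u minEle; case: ifP => _; [left|by right].
by rewrite divfK ?gt_eqF.
Qed.

Lemma delta_step_descent a m n :
  tau < dgap a m n -> delta a m < 1 -> 0 < delta a n ->
  descent_move a (delta_step Ks xs gamma a m n).
Proof.
move=> g am an; have g0 := lt_trans Htau g; have e0 := delta_gap_dist_gt0 g0.
rewrite /delta_step; set eta := Ksd m n in e0 *.
set u := Num.min (dgap a m n / eta) _.
have u0 : 0 < u by rewrite !lt_min an subr_gt0 am divr_gt0.
have ule : u <= dgap a m n / eta by rewrite ge_min lexx.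
have -> : [ffun k => delta a k + (if k == m then u else 0)
                       - (if k == n then u else 0)] =
          transfer (delta a) n m u.
  by apply/ffunP => k; rewrite !ffunE addrAC.
apply: (@DeltaMove _ _ m n u) => //.
  rewrite objective_delta_transfer -/eta.
  have := clipped_descent Htau g e0 u0 ule; lra.
rewrite /u !minEle; case: ifP => _.
  by apply: Or31; rewrite divfK ?gt_eqF.
by case: ifP => _; [apply: Or33 | apply: Or32].
Qed.

(** The pair behind the violation may differ from [(i, j)], but the argmax and argmin conditions on
    [(i, j)] make its gap at least as large. *)
Lemma alpha_violation_gap a W i j :
  (tau%:E < alpha_violation K Ks x xs nu gamma a W)%E ->
  alpha_pair K Ks x xs nu gamma a W (i, j) -> tau < agap a i j.
Proof.
rewrite /alpha_violation; case: pickP => // -[i0 j0].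
move=> /and5P[/= i0W ai0 _ j0W _]; rewrite lte_fin => g.
move=> /and5P[/= _ _ /forallP/(_ i0)/implyP/(_ i0W)/implyP/(_ ai0) gi _].
move=> /forallP/(_ j0)/implyP/(_ j0W) gj.
by move: g gi gj; rewrite /alpha_gap; lra.
Qed.

Lemma delta_violation_gap a W m n :
  (tau%:E < delta_violation Ks xs gamma a W)%E ->
  delta_pair Ks xs gamma a W (m, n) -> tau < dgap a m n.
Proof.
rewrite /delta_violation; case: pickP => // -[m0 n0].
move=> /and5P[/= m0W am0 _ n0W /andP[an0 _]]; rewrite lte_fin => g.
move=> /and5P[/= _ _ /forallP/(_ m0)/implyP/(_ m0W)/implyP/(_ am0) gm _].
move=> /andP[_ /forallP/(_ n0)/implyP/(_ n0W)/implyP/(_ an0) gn].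
by move: g gm gn; rewrite /delta_gap; lra.
Qed.

(** Each branch is guarded by a violation above [tau] on the very set from which its pair is drawn,
    whatever that set is. *)
Lemma iteration_descent selC selCs a b :
  iteration K Ks x xs nu gamma tau selC selCs a b -> descent_move a b.
Proof.
have HA W : (tau%:E < alpha_violation K Ks x xs nu gamma a W)%E ->
    (exists i j, alpha_pair K Ks x xs nu gamma a W (i, j) /\
       b = alpha_step K Ks x xs nu gamma a i j) -> descent_move a b.
  move=> vW [i [j [pij ->]]]; apply: alpha_step_descent.
    exact: alpha_violation_gap pij.
  by case/and5P: pij.
have HD W : (tau%:E < delta_violation Ks xs gamma a W)%E ->
    (exists m n, delta_pair Ks xs gamma a W (m, n) /\
       b = delta_step Ks xs gamma a m n) -> descent_move a b.
  move=> vW [m [n [pmn ->]]]; apply: delta_step_descent.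
  - exact: delta_violation_gap pmn.
  - by case/and5P: pmn.
  - by case/and5P: pmn => _ _ _ _ /andP[].
rewrite /iteration /next_instruction.
case: ifP => [/andP[/HA] //|_]; case: ifP => [/andP[/HD] //|_].
case: ifP => [/HA //|_]; case: ifP => [/andP[/HA] //|_].
by case: ifP => [/andP[/HD] //|].
Qed.

(** * Drift of the coefficients and of the gradient *)

Definition within (d : R) a b : Prop :=
  forall k, `|alpha a k - alpha b k| <= d /\ `|delta a k - delta b k| <= d.

(** No coefficient moves by more than [u], and the objective pays at least [tau * u]. Bounding the
    drift by the drop makes it telescope along a run. *)
Lemma descent_move_within a b : descent_move a b ->
  within ((objective a - objective b) / tau) b a.
Proof.
have le u : objective b <= objective a - tau * u ->
    u <= (objective a - objective b) / tau.
  by move=> o; rewrite ler_pdivlMr //; lra.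
have ne g (i j : 'I_l) : tau < g i - g j -> i != j.
  by apply: contraTneq => ->; rewrite subrr -leNgt ltW.
case=> [i j u g _ u0 /le o ea ed _|m n u g _ _ u0 /le o ea ed _] k;
  rewrite ea ed subrr normr0 (le_trans (ltW u0) o).
  split=> //; apply: le_trans o; apply: transfer_drift (ltW u0).
  by apply: (ne (fun k => f a k + fs a k)); move: g; rewrite /alpha_gap; lra.
split=> //; apply: le_trans o; apply: transfer_drift (ltW u0).
by rewrite eq_sym; apply: (ne (fs a)).
Qed.

Lemma gradient_lipschitz : exists2 M : R, 0 <= M & forall d a b k, within d a b ->
  `|f a k - f b k| + `|fs a k - fs b k| <= M * d.
Proof.
(* The factor 2 arises because [alpha - delta] can move by [2 * d]; summing over [k] below makes the
   constant uniform. *)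
pose M k := (nu * l%:R)^-1 * (\sum_p `|K (x p) (x k)|)
  + gamma^-1 * (2 * \sum_p `|Ks (xs p) (xs k)|).
have M0 k : 0 <= M k.
  apply: addr_ge0; apply: mulr_ge0; rewrite ?invr_ge0 ?(ltW Hnul) ?(ltW Hgamma) //.
    exact: sumr_ge0.
  by rewrite mulr_ge0 // sumr_ge0.
exists (\sum_k M k) => [|d a b k ab]; first exact: sumr_ge0.
have d0 : 0 <= d by apply: le_trans (ab k).1.
apply: le_trans (ler_wpM2r d0 (le_sum_term k M0)).
have n0 : 0 < (nu * l%:R)^-1 by rewrite invr_gt0.
have g0 : 0 < gamma^-1 by rewrite invr_gt0.
rewrite /M mulrDl /Defs.f /Defs.fs -!mulrBr !normrM (gtr0_norm n0) (gtr0_norm g0).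
rewrite lerD // -!mulrA ler_pM2l //.
  by rewrite [leRHS]mulrC; apply: norm_combination_sub => p; case: (ab p).
rewrite [_ * d]mulrC mulrA; apply: norm_combination_sub => p.
case: (ab p) => ap dp.
rewrite (_ : _ - _ = (alpha a p - alpha b p) - (delta a p - delta b p)); last ring.
by apply: le_trans (ler_normB _ _) _; lra.
Qed.

(** * Contradiction from an infinite run *)

Lemma no_infinite_descent (run : nat -> state R l) :
  ~ forall t, descent_move (run t) (run t.+1).
Proof.
move=> step; have tau0 : 0 < tau by [].
have [M M0 lipM] := gradient_lipschitz.
pose eta (p : 'I_l * 'I_l) : R := Kd p.1 p.2 + Ksd p.1 p.2.
have eta0 p : 0 <= eta p by rewrite addr_ge0 ?Kdist_ge0 ?Ksdist_ge0.
pose B : R := \sum_p eta p; have B0 : 0 <= B by rewrite sumr_ge0.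
have etaB i j : Kd i j + Ksd i j <= B by apply: (le_sum_term (i, j) eta0).
have KsB i j : Ksd i j <= B by apply: le_trans (etaB i j); rewrite lerDr Kdist_ge0.
(* One drift bound [d = tau / N] serves three purposes: [B] rules out unclipped steps, [2 * M]
   preserves the order of the gradient, and [4 * tau] keeps each delta within 1/4 of its frozen
   value. *)
pose N : R := 4 * tau + B + 2 * M.
have N0 : 0 < N by rewrite /N; lra.
pose d : R := tau / N; have d0 : 0 < d by rewrite divr_gt0.
have dN : d * N = tau by rewrite divfK ?gt_eqF.
have dB : d * B <= tau by rewrite -dN ler_pM2l // /N; lra.
have dM : 2 * (M * d) <= tau.
  by rewrite mulrA mulrC -dN ler_pM2l // /N; lra.
have d4 : d <= 1 / 4.
  have : d * (4 * tau) <= 1 * tau by rewrite mul1r -[leRHS]dN ler_pM2l // /N; lra.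
  by rewrite mulrA ler_pM2r //; lra.
have [T FT] := eventually_small_drop (fun t => objective_ge0 (run t))
  (mulr_gt0 Htau d0).
pose a s := run (T + s)%N; pose a0 := run T.
have near s : within d (a s) a0.
  suff H : within ((objective a0 - objective (a s)) / tau) (a s) a0.
    have e : (objective a0 - objective (a s)) / tau <= d.
      by rewrite ler_pdivrMr // mulrC ltW // FT.
    by move=> k; have [h1 h2] := H k; split; exact: le_trans e.
  elim: s => [|s IHs] k.
    by rewrite /a addn0 !subrr mul0r normr0.
  have [h1 h2] := IHs k.
  have := descent_move_within (step (T + s)%N); rewrite -addnS => /(_ k)[].
  rewrite -/(a s) -/(a s.+1) => h3 h4.
  have -> : objective a0 - objective (a s.+1) =
    (objective (a s) - objective (a s.+1)) + (objective a0 - objective (a s)).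
    by ring.
  rewrite mulrDl; split.
    rewrite -(subrKA (alpha (a s) k)); apply: le_trans (ler_normD _ _) _.
    exact: lerD.
  rewrite -(subrKA (delta (a s) k)); apply: le_trans (ler_normD _ _) _.
  exact: lerD.
have mono s : objective (a s) <= objective a0.
  elim: s => [|s IHs]; first by rewrite /a addn0.
  apply: le_trans IHs; have := step (T + s)%N; rewrite -addnS -/(a s) -/(a s.+1).
  by case=> [i j u _ _ u0 o _ _ _|m n u _ _ _ u0 o _ _ _];
    have := mulr_gt0 tau0 u0; lra.
have short s u : objective (a s.+1) <= objective (a s) - tau * u -> u <= d.
  move=> o; have := FT (T + s.+1)%N; rewrite -/(a s.+1) -/a0.
  have := mono s => o1 o2; rewrite ltW // -(ltr_pM2l tau0); lra.
have fs_near s k : `|fs (a s) k - fs a0 k| <= M * d.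
  by apply: le_trans (lipM _ _ _ k (near s)); rewrite lerDr.
have g_near s k : `|f (a s) k + fs (a s) k - (f a0 k + fs a0 k)| <= M * d.
  rewrite opprD addrACA; apply: le_trans (lipM _ _ _ k (near s)).
  exact: ler_normD.
(* Abstracting the product [M * d] leaves linear goals for [lra]. *)
move: (M * d) dM fs_near g_near => e e2 fs_near g_near.
(* The sign makes alpha mass, which leaves large values of [f + fs], flow upwards in [g]. Delta mass
   already flows upwards in [fs]. *)
pose g k := - (f a0 k + fs a0 k).
(* Splitting at 1/2 with drift at most 1/4 keeps the low deltas away from 1 and the others away from
   0. Alphas are clipped only at 0, hence [xpredT] below. *)
pose low := [pred k | delta a0 k <= 1 / 2].
pose Psi s := (potential g xpredT (alpha (a s)) +
               potential (fs a0) low (delta (a s)))%N.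
have lowP s k : low k -> delta (a s) k < 1.
  by move=> /=; have [_] := near s k; rewrite ler_norml; lra.
have highP s k : ~~ low k -> 0 < delta (a s) k.
  by rewrite /= -ltNge; have [_] := near s k; rewrite ler_norml; lra.
have Psi_decr s : (Psi s.+1 < Psi s)%N.
  have := step (T + s)%N; rewrite -addnS -/(a s) -/(a s.+1).
  case=> [i j u gap ai u0 /short ud ea ed clip|
          m n u gap dm dn u0 /short ud ea ed clip].
    rewrite /Psi ed ltn_add2r ea; apply: potential_transfer => //.
      move: gap (g_near s i) (g_near s j).
      by rewrite /alpha_gap /g !ler_norml; lra.
    left; split=> //; case: clip => // long.
    have : u * (Kd i j + Ksd i j) <= d * B.
      by rewrite ler_pM ?addr_ge0 ?Kdist_ge0 ?Ksdist_ge0 // ltW.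
    lra.
  have fmn : fs a0 n < fs a0 m.
    move: gap (fs_near s m) (fs_near s n).
    by rewrite /delta_gap !ler_norml; lra.
  have mn : m != n by apply: contraTneq fmn => ->; rewrite ltxx.
  rewrite /Psi ea ltn_add2l ed; apply: potential_transfer => //.
    by rewrite dm orbT.
  case: clip => [long|un|um].
  - have : u * Ksd m n <= d * B by rewrite ler_pM ?Ksdist_ge0 // ltW.
    lra.
  (* A non-low [n] would stay positive after the step, yet the clipping has just made it 0; dually
     for [m] below. *)
  - left; split=> //; apply: contraT => /(highP s.+1).
    by rewrite ed ffunE eqxx eq_sym (negPf mn) un subrr addr0 ltxx.
  right; split=> //; apply/negP => /(lowP s.+1).
  by rewrite ed ffunE eqxx (negPf mn) um subr0 addrC subrK ltxx.
have Psi_le s : (Psi s + s <= Psi 0)%N.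
  by elim: s => [|s IHs]; have := Psi_decr; [|move=> /(_ s)]; lia.
by have := Psi_le (Psi 0).+1; rewrite addnS ltnNge leq_addl.
Qed.

End Descent.

Unset Implicit Arguments.

Theorem theorem1 (R : realType) (l : nat) (X Xs : Type)
    (V Vs : lmodType R)
    (ip : {dot V for idfun}) (ips : {dot Vs for idfun})
    (phi : X -> V) (phis : Xs -> Vs)
    (K : X -> X -> R) (Ks : Xs -> Xs -> R)
    (HK : forall y z : X, K y z = ip (phi y) (phi z))
    (HKs : forall y z : Xs, Ks y z = ips (phis y) (phis z))
    (x : 'I_l -> X) (xs : 'I_l -> Xs)
    (nu gamma tau : R)
    (Hl : (0 < l)%N) (Hnu : l%:R^-1 < nu < 1)
    (Hgamma : 0 < gamma) (Htau : 0 < tau)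
    (selC selCs : {set cell})
    (HC : forall a : state R l, cache selC a \subset cache selCs a)
    (run : nat -> state R l) :
  smo_run K Ks x xs nu gamma tau selC selCs run ->
  exists N : nat, stops_at K Ks x xs nu gamma tau selC selCs run N.
Proof.
move=> [_ step]; apply: boolp.contrapT => nostop.
have Hnul : 0 < nu * l%:R.
  have l0 : 0 < l%:R :> R by rewrite ltr0n.
  case/andP: Hnu => Hnu _; rewrite mulr_gt0 // (lt_trans _ Hnu) //.
  by rewrite invr_gt0.
apply: (no_infinite_descent HK HKs (x := x) (xs := xs) Hnul Hgamma Htau
          (run := run)) => t.
by apply: iteration_descent (step t _) => // st; apply: nostop; exists t.
Qed.
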